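(* Let $|||\cdot|||$ be a symmetric norm on $\mathcal{M}_n$, let $A,B\in\mathcal{P}_n$, $K\in\mathcal{M}_n$, and let $p,q,s\in\mathbb{R}$. Put $$\tilde\Psi_{p,q,s}(A,B)=\left|\left|\left|\left(B^{\frac q2}K^*A^pKB^{\frac q2}\right)^s\right|\right|\right|.$$ (i) If $s,p,q>0$, or if $s>0$ and $p,q<0$, then $$\tilde\Psi_{p,q,s}(A,B)=\min_{Z>0}\left\{\left|\left|\left|(Z^{-\frac12}K^*A^pKZ^{-\frac12})^{\frac{s(p+q)}{p}}\right|\right|\right|^{\frac{p}{p+q}}\cdot\left|\left|\left|(Z^{\frac12}B^qZ^{\frac12})^{\frac{s(p+q)}{q}}\right|\right|\right|^{\frac{q}{p+q}}\right\}$$ and $$\tilde\Psi_{p,q,s}(A,B)=\min_{Z>0}\left\{\frac{p}{p+q}\left|\left|\left|(Z^{-\frac12}K^*A^pKZ^{-\frac12})^{\frac{s(p+q)}{p}}\right|\right|\right|+\frac{q}{p+q}\left|\left|\left|(Z^{\frac12}B^qZ^{\frac12})^{\frac{s(p+q)}{q}}\right|\right|\right|\right\}.$$ (ii) If $s>0,\ p>0,\ q<0$ with $p+q>0$, or if $s>0,\ p<0,\ q>0$ with $p+q<0$, then $$\tilde\Psi_{p,q,s}(A,B)=\max_{Z>0}\left\{\left|\left|\left|(Z^{-\frac12}K^*A^pKZ^{-\frac12})^{\frac{s(p+q)}{p}}\right|\right|\right|^{\frac{p}{p+q}}\cdot\left|\left|\left|(Z^{\frac12}B^qZ^{\frac12})^{\frac{s(p+q)}{q}}\right|\right|\right|^{\frac{q}{p+q}}\right\}$$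 and $$\tilde\Psi_{p,q,s}(A,B)=\max_{Z>0}\left\{\frac{p}{p+q}\left|\left|\left|(Z^{-\frac12}K^*A^pKZ^{-\frac12})^{\frac{s(p+q)}{p}}\right|\right|\right|+\frac{q}{p+q}\left|\left|\left|(Z^{\frac12}B^qZ^{\frac12})^{\frac{s(p+q)}{q}}\right|\right|\right|\right\}.$$
   Context: $\mathcal{M}_n$ is the set of $n\times n$ matrices and $\mathcal{P}_n$ the set of $n\times n$ positive definite matrices; $Z>0$ means $Z\in\mathcal{P}_n$. Powers of positive (semi)definite matrices are taken by functional calculus. A symmetric gauge function is a norm $\Phi$ on $\mathbb{R}^n$, invariant under permutations of coordinates and under sign changes of coordinates, with $\Phi(1,0,\ldots,0)=1$. A symmetric norm on $\mathcal{M}_n$ is a norm of the form $|||A|||=\Phi(s(A))$, where $\Phi$ is a symmetric gauge function and $s(A)=(s_1(A),\ldots,s_n(A))$ is the vector of singular values of $A$ in decreasing order.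
   Formalization: For singular K the min/max need not be attained (for K=0 and p,q,s>0 the sum form is positive at every Z>0 but Ψ=0), so min/max is proved as infimum/supremum over Z>0 for every K, and as an attained minimum/maximum for every invertible K. *)

(* Defs.v *)
From HB Require Import structures.
From mathcomp Require Import all_boot all_order all_fingroup all_algebra.
From mathcomp Require Import sesquilinear spectral complex.
From mathcomp Require Import boolp classical_sets reals exp.
Set Implicit Arguments.
Unset Strict Implicit.
Unset Printing Implicit Defensive.
Import Order.TTheory GRing.Theory Num.Theory.
Local Open Scope classical_set_scope.
Local Open Scope ring_scope.
Local Open Scope sesquilinear_scope.
Local Open Scope complex_scope.

Definition posdefmx (R : realType) (n : nat) : set 'M[R[i]]_n :=
  [set A | A \is hermsymmx /\
     forall u : 'cV[R[i]]_n, u != 0 -> 0 < (u ^t* *m A *m u) 0 0].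
Arguments posdefmx {R n}.

(* Functional calculus for t |-> t `^ r; meaningful for positive semidefinite
   A, whose spectral_diag is real and nonnegative.  For r != 0, 0 `^ r = 0. *)
Definition mxpowR (R : realType) (n : nat) (A : 'M[R[i]]_n) (r : R) :
    'M[R[i]]_n :=
  invmx (spectralmx A)
  *m diag_mx (map_mx (fun z => (complex.Re z `^ r)%:C) (spectral_diag A))
  *m spectralmx A.

Definition singular_values (R : realType) (n : nat) (A : 'M[R[i]]_n) :
    'rV[R]_n :=
  \row_i nth 0 (sort >=%R
    [seq Num.sqrt (complex.Re (spectral_diag (A ^t* *m A) 0 j)) | j : 'I_n]) i.

(* modulus is the absolute value on the scalars, with values in R; it is a
   parameter because the norms on complex matrices are R-valued, too. *)
Definition is_norm (R : realType) (F : fieldType) (modulus : F -> R)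
    (V : lmodType F) (N : V -> R) : Prop :=
  [/\ forall x, N x = 0 -> x = 0,
      forall a x, N (a *: x) = modulus a * N x &
      forall x y, N (x + y) <= N x + N y].

Definition symmetric_gauge (R : realType) (n : nat) (Phi : 'rV[R]_n.+1 -> R) :
    Prop :=
  [/\ is_norm (fun a : R => `|a|) Phi,
      forall (sigma : 'S_n.+1) (x : 'rV_n.+1), Phi (col_perm sigma x) = Phi x,
      forall (e : 'I_n.+1 -> bool) (x : 'rV_n.+1),
        Phi (\row_j ((-1) ^+ e j * x 0 j)) = Phi x &
      Phi (delta_mx 0 0) = 1].

Definition symmetric_norm (R : realType) (n : nat)
    (N : 'M[R[i]]_n.+1 -> R) : Prop :=
  is_norm (fun a : R[i] => complex.Re `|a|) N /\
  exists2 Phi : 'rV[R]_n.+1 -> R,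
    symmetric_gauge Phi & forall A, N A = Phi (singular_values A).

Definition Psi (R : realType) (n : nat) (N : 'M[R[i]]_n -> R)
    (K A B : 'M[R[i]]_n) (p q s : R) : R :=
  N (mxpowR (mxpowR B (q / 2) *m K ^t* *m mxpowR A p *m K
             *m mxpowR B (q / 2)) s).

Definition left_factor (R : realType) (n : nat) (N : 'M[R[i]]_n -> R)
    (K A : 'M[R[i]]_n) (p q s : R) (Z : 'M[R[i]]_n) : R :=
  N (mxpowR (mxpowR Z (- (1 / 2)) *m K ^t* *m mxpowR A p *m K
             *m mxpowR Z (- (1 / 2))) (s * (p + q) / p)).

Definition right_factor (R : realType) (n : nat) (N : 'M[R[i]]_n -> R)
    (B : 'M[R[i]]_n) (p q s : R) (Z : 'M[R[i]]_n) : R :=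
  N (mxpowR (mxpowR Z (1 / 2) *m mxpowR B q *m mxpowR Z (1 / 2))
            (s * (p + q) / q)).

Definition product_form (R : realType) (n : nat) (N : 'M[R[i]]_n -> R)
    (K A B : 'M[R[i]]_n) (p q s : R) (Z : 'M[R[i]]_n) : R :=
  left_factor N K A p q s Z `^ (p / (p + q))
  * right_factor N B p q s Z `^ (q / (p + q)).

Definition sum_form (R : realType) (n : nat) (N : 'M[R[i]]_n -> R)
    (K A B : 'M[R[i]]_n) (p q s : R) (Z : 'M[R[i]]_n) : R :=
  p / (p + q) * left_factor N K A p q s Z
  + q / (p + q) * right_factor N B p q s Z.

(* The extremum of f over Z > 0 is m, and it is attained if K is invertible.
   For singular K it need not be attained: if K = 0 and p, q, s > 0, then Psi = 0
   but sum_form is positive at every Z > 0.  When m is attained, membership in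
   infimums (supremums) says that m is the minimum (maximum). *)
Definition min_posdef (R : realType) (n : nat) (K : 'M[R[i]]_n)
    (f : 'M[R[i]]_n -> R) (m : R) : Prop :=
  infimums (f @` posdefmx) m /\ (K \in unitmx -> (f @` posdefmx) m).

Definition max_posdef (R : realType) (n : nat) (K : 'M[R[i]]_n)
    (f : 'M[R[i]]_n -> R) (m : R) : Prop :=
  supremums (f @` posdefmx) m /\ (K \in unitmx -> (f @` posdefmx) m).

(* Main.v *)
(** Write [T'] for the adjoint of [T].  With [X = A^(p/2) K Z^(-1/2)],
    [Y = Z^(1/2) B^(q/2)] and [t = p / (p + q)], the three norms are those of
    [|X Y|^(2s)], [|X|^(2s/t)] and [|Y'|^(2s/(1-t))], so that for [0 < t < 1]
    the lower bound is the Hoelder inequality for symmetric norms.  For [t > 1]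
    the upper bound is the same inequality for the factorization
    [X = (X Y) Y^-1].  Hoelder's inequality follows from Horn's
    log-majorization [prod_(i<k) s_i(X Y) <= prod_(i<k) s_i(X) s_i(Y)]; this
    comes from an averaged Cauchy-Binet formula, by which [det (W H W')] is at
    most [det (W W')] times the product of the [k] largest eigenvalues of [H].
    By the weighted AM-GM inequality and its reverse, the product form lies
    between the left-hand side and the sum form.  All three agree if [Y' Y]
    commutes with [(X Y)' (X Y)] and has the eigenvalues [d_i^(1-t)], where the
    [d_i] are those of [(X Y)' (X Y)]; if [K] is singular, the vanishing [d_i]
    are perturbed, which gives the extremum as a limit. *)

Require Import Defs.
From HB Require Import structures.
From mathcomp Require Import all_boot all_order all_fingroup all_algebra.
From mathcomp Require Import sesquilinear spectral complex.
From mathcomp Require Import boolp classical_sets reals exp.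
From mathcomp Require Import ring lra.
Set Implicit Arguments.
Unset Strict Implicit.
Unset Printing Implicit Defensive.
Import Order.TTheory GRing.Theory Num.Theory.
Local Open Scope ring_scope.

(** * Symmetric gauge functions *)

Section SymmetricGauge.
Variables (R : realType) (n : nat) (Phi : 'rV[R]_n.+1 -> R).
Hypothesis gPhi : symmetric_gauge Phi.
Implicit Types x y : 'rV[R]_n.+1.

Lemma gaugeZ a x : Phi (a *: x) = `|a| * Phi x.
Proof. by case: gPhi => -[]. Qed.

Lemma gauge_leD x y : Phi (x + y) <= Phi x + Phi y.
Proof. by case: gPhi => -[]. Qed.

Lemma gauge0 : Phi 0 = 0.
Proof. by rewrite -(scale0r 0) gaugeZ normr0 mul0r. Qed.

Lemma gauge_ge0 x : 0 <= Phi x.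
Proof.
have := gauge_leD x (- 1 *: x).
by rewrite gaugeZ normrN1 scaleN1r subrr gauge0; lra.
Qed.

Lemma gauge_gt0 x i : x 0 i != 0 -> 0 < Phi x.
Proof.
move=> xi0; rewrite lt_def gauge_ge0 andbT; apply: contra_neq xi0.
by case: gPhi => -[/(_ x) + _ _ _ _ _] => /[apply] ->; rewrite mxE.
Qed.

(** Used with [y] the image of [x] under a sign change or a transposition: averaging over a symmetry
    of [Phi] does not increase it. *)
Lemma gauge_convex a x y : 0 <= a <= 1 -> Phi x = Phi y ->
  Phi ((1 - a) *: x + a *: y) <= Phi x.
Proof.
move=> /andP[a0 a1] xy; apply: le_trans (gauge_leD _ _) _.
rewrite !gaugeZ !ger0_norm ?subr_ge0// -xy; lra.
Qed.

(* Scaling one coordinate by [u] averages [x] with its image under the sign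
   change of that coordinate. *)
Lemma gauge_scale_coord u i x : 0 <= u <= 1 ->
  Phi (\row_j (if j == i then u * x 0 j else x 0 j)) <= Phi x.
Proof.
move=> /andP[u0 u1].
have -> : \row_j (if j == i then u * x 0 j else x 0 j) =
    (1 - (1 - u) / 2) *: x +
    ((1 - u) / 2) *: \row_j ((-1) ^+ (j == i) * x 0 j).
  apply/rowP => j; rewrite !mxE; case: eqP => _; rewrite ?expr1 ?expr0; lra.
have u01 : 0 <= (1 - u) / 2 <= 1 by lra.
apply: (gauge_convex u01).
by case: gPhi => _ _ -> _.
Qed.

(** The coordinates of [y] are replaced by those of [x] one at a time; where [y_i > 0] this scales
    one coordinate by [x_i / y_i], which lies in [[0, 1]]. *)
Lemma gauge_le x y : (forall j, 0 <= x 0 j <= y 0 j) -> Phi x <= Phi y.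
Proof.
move=> xy; pose z k := \row_(j < n.+1) (if (j < k)%N then x 0 j else y 0 j).
have -> : x = z n.+1 by apply/rowP => j; rewrite mxE ltn_ord.
elim: (n.+1) => [|k /(le_trans _)]; last apply.
  by rewrite le_eqVlt (_ : z 0%N = y) ?eqxx//; apply/rowP => j; rewrite mxE.
(* The induction runs over all [k]; from [n.+1] on, [z] is constant. *)
have [kn|nk] := ltnP k n.+1; last first.
  rewrite (_ : z k.+1 = z k)//; apply/rowP => j; rewrite !mxE.
  by rewrite !(leq_trans (ltn_ord j))// leqW.
pose i := Ordinal kn; have /andP[xi0 xyi] := xy i.
have [yi0|yi0] := eqVneq (y 0 i) 0.
  rewrite (_ : z k.+1 = z k)//; apply/rowP => j; rewrite !mxE ltnS leq_eqVlt.
  have [jk|//] := eqVneq (j : nat) k; rewrite jk ltnn.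
  have -> : j = i by apply: val_inj.
  by apply/eqP; rewrite eq_le xyi yi0 xi0.
have yi : 0 < y 0 i by rewrite lt_def yi0 (le_trans xi0).
rewrite (_ : z k.+1 = \row_j (if j == i then x 0 i / y 0 i * z k 0 j
  else z k 0 j)); last first.
  apply/rowP => j; rewrite !mxE ltnS leq_eqVlt -(inj_eq val_inj) /=.
  have [jk|//] := eqVneq (j : nat) k; rewrite jk ltnn.
  by have -> : j = i by [apply: val_inj]; rewrite divfK.
by apply: gauge_scale_coord; rewrite divr_ge0 ?(ltW yi)//= ler_pdivrMr ?mul1r.
Qed.

Lemma gauge_perm (s : 'S_n.+1) x : Phi (\row_j x 0 (s j)) = Phi x.
Proof.
case: gPhi => _ /(_ s x) <- _ _; congr Phi; apply/rowP => j.
by rewrite !mxE.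
Qed.

(** The new vector is dominated coordinatewise by a convex combination of [y] and of [y] with the
    coordinates [i] and [j] exchanged. *)
Lemma gauge_transfer (y : 'rV[R]_n.+1) (i j : 'I_n.+1) (c : R) :
  i != j -> (forall l, 0 <= y 0 l) -> 1 <= c -> y 0 j * c <= y 0 i / c ->
  Phi (\row_l (if l == i then y 0 i / c else
               if l == j then y 0 j * c else y 0 l)) <= Phi y.
Proof.
move=> ij y0 c1 yij.
have c0 : 0 < c by lra.
set a := y 0 i; set b := y 0 j; rewrite -/a -/b in yij.
have [a0 b0] : 0 <= a /\ 0 <= b by split; apply: y0.
pose d := a / c; have ad : a = d * c by rewrite /d divfK// gt_eqF.
have d0 : 0 <= d by rewrite divr_ge0// ltW.
rewrite -/d in yij *.
have bd : b <= d by apply: le_trans yij; rewrite ler_peMr.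
have [ab|ab] := eqVneq a b.
  apply: gauge_le => l; rewrite !mxE; case: eqP => [->|_].
    by rewrite -/a d0 ad ler_peMr.
  case: eqP => [->|_]; last by rewrite y0/=.
  by rewrite -/b mulr_ge0//= ?(ltW c0)// -ab ad; nra.
have ab' : 0 < a - b.
  by rewrite subr_gt0 lt_def ab (le_trans bd)// ad ler_peMr.
(* This weight gives exactly [d] at [i], and [a + b - d] at [j], which is at least [b * c] because
   [(c - 1) * (d - b) >= 0]. *)
pose u := (a - d) / (a - b).
have u01 : 0 <= u <= 1.
  rewrite /u divr_ge0 ?(ltW ab')//= ?subr_ge0 ?ad ?ler_peMr//.
  by rewrite -ad ler_pdivrMr// mul1r lerB.
pose y' := \row_l y 0 (tperm i j l).
have := @gauge_convex u y y' u01 (esym (gauge_perm _ _)).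
apply: le_trans; apply: gauge_le => l; rewrite !mxE.
have uE : u * (a - b) = a - d by rewrite /u divfK// gt_eqF.
case: eqP => [->|li].
  rewrite tpermL -/a -/b d0/=; lra.
case: eqP => [->|lj]; last first.
  by rewrite tpermD ?y0 1?eq_sym; [lra|apply/eqP..].
rewrite tpermR -/a -/b mulr_ge0 ?(ltW c0)//=.
nra.
Qed.

(* Each step of the induction moves [y] towards [x] by a multiplicative
   Robin Hood transfer from a coordinate [i] with [x_i < y_i] to the first
   coordinate [j] with [y_j < x_j]. *)
Lemma gauge_weak_log_majorization x y :
  (forall i, 0 <= x 0 i) -> (forall i, 0 <= y 0 i) ->
  (forall i j : 'I_n.+1, (i <= j)%N -> x 0 j <= x 0 i) ->
  (forall m : 'I_n.+1, \prod_(l < n.+1 | (l <= m)%N) x 0 l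
                    <= \prod_(l < n.+1 | (l <= m)%N) y 0 l) ->
  Phi x <= Phi y.
Proof.
move=> x0 y0 xs.
have [k] := ubnP #|[set l | x 0 l != y 0 l]|.
elim: k y y0 => // k IHk y y0 cardk xy.
have [/existsP[j0 j0P]|] := boolP [exists j, y 0 j < x 0 j]; last first.
  rewrite negb_exists => /forallP yx; apply: gauge_le => j.
  by rewrite x0 leNgt yx.
case: (@arg_minnP _ j0 (fun j => y 0 j < x 0 j) (@nat_of_ord _) j0P).
move=> j yxj jmin.
have xyl (l : 'I_n.+1) : (l < j)%N -> x 0 l <= y 0 l.
  by move=> lj; rewrite leNgt; apply/negP => /jmin; rewrite leqNgt lj.
have xpos (l : 'I_n.+1) : (l <= j)%N -> 0 < x 0 l.
  by move=> /xs; apply: lt_le_trans; apply: le_lt_trans yxj.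
have xprod : 0 < \prod_(l < n.+1 | (l <= j)%N) x 0 l by rewrite prodr_gt0.
have ypos (l : 'I_n.+1) : (l <= j)%N -> 0 < y 0 l.
  move=> lj; rewrite lt_def y0 andbT; apply/eqP => yl.
  have := lt_le_trans xprod (xy j).
  by rewrite (bigD1 l)//= yl mul0r ltxx.
(* Otherwise [x] and [y] agree before [j], and [y_j < x_j] contradicts the inequality between the
   products up to [j]. *)
have [i /andP[ij xyi]] : exists i : 'I_n.+1, (i < j)%N && (x 0 i < y 0 i).
  apply/existsP; apply: contraTT (xy j).
  rewrite negb_exists -ltNge => /forallP noi.
  rewrite (bigD1 j)//= [ltRHS](bigD1 j)//=.
  rewrite (eq_bigr (x 0)) => [|l]; last first.
    rewrite andbC -ltn_neqAle => lj; apply/eqP; rewrite eq_le xyl// andbT.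
    by have := noi l; rewrite lj -leNgt.
  rewrite ltr_pM2r//; apply: prodr_gt0 => l /andP[lj _]; exact: xpos.
have [xi yi] := (xpos _ (ltnW ij), ypos _ (ltnW ij)).
have [xj yj] := (xpos _ (leqnn j), ypos _ (leqnn j)).
have ij' : i != j by rewrite -(inj_eq val_inj) neq_ltn ij.
(* The largest factor for which neither coordinate passes its target: one of them reaches it, so
   fewer coordinates of [x] and [y] differ. *)
pose c := Num.min (y 0 i / x 0 i) (x 0 j / y 0 j).
have c1 : 1 < c by rewrite lt_min !ltr_pdivlMr// !mul1r xyi.
have c0 : 0 < c by rewrite (lt_trans _ c1).
have xic : x 0 i <= y 0 i / c.
  by rewrite ler_pdivlMr// mulrC -ler_pdivlMr// ge_min lexx.
have yjc : y 0 j * c <= x 0 j.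
  by rewrite mulrC -ler_pdivlMr// ge_min lexx orbT.
have le_c : y 0 j * c <= y 0 i / c.
  by rewrite (le_trans yjc)// (le_trans _ xic)// xs// ltnW.
apply: le_trans (gauge_transfer ij' y0 (ltW c1) le_c).
set y' := (\row_l _).
have y'i : y' 0 i = y 0 i / c by rewrite mxE eqxx.
have y'j : y' 0 j = y 0 j * c by rewrite mxE eqxx eq_sym (negbTE ij').
have y'l l : l != i -> l != j -> y' 0 l = y 0 l.
  by rewrite mxE => /negbTE-> /negbTE->.
apply: IHk => [l||m].
- have [->|li] := eqVneq l i; first by rewrite y'i ltW// divr_gt0.
  have [->|lj] := eqVneq l j; first by rewrite y'j ltW// mulr_gt0.
  by rewrite y'l.
- rewrite ltnS in cardk; apply: leq_trans cardk; apply: proper_card.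
  apply/properP; split.
    apply/fintype.subsetP => l; rewrite !inE.
    have [->|li] := eqVneq l i; first by rewrite (lt_eqF xyi).
    have [->|lj] := eqVneq l j; first by rewrite (gt_eqF yxj).
    by rewrite y'l.
  have [cE|cE] := leP (y 0 i / x 0 i) (x 0 j / y 0 j).
    exists i; rewrite !inE ?(lt_eqF xyi)// y'i /c min_l//.
    rewrite invf_div mulrCA divff ?mulr1.
      by rewrite eqxx.
    by rewrite gt_eqF.
  exists j; rewrite !inE ?(gt_eqF yxj)// y'j /c min_r ?ltW//.
  rewrite mulrC divfK ?eqxx//.
  by rewrite gt_eqF.
(* Before [j] the vector [y'] still dominates [x]; from [j] on both changed factors occur in the
   product and [c] cancels. *)
- have [mj|jm] := ltnP m j.
    apply: ler_prod => l lm; rewrite x0/=.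
    have lj : (l < j)%N by apply: leq_ltn_trans mj.
    have [->|li] := eqVneq l i; first by rewrite y'i.
    by rewrite y'l ?xyl//; apply: contraTneq lj => ->; rewrite ltnn.
  apply: le_trans (xy m) _; rewrite le_eqVlt; apply/orP; left; apply/eqP.
  have im : (i <= m)%N by apply: leq_trans jm; apply: ltnW.
  rewrite (bigD1 i)//= (bigD1 j)/=; last by rewrite jm eq_sym.
  rewrite [RHS](bigD1 i)//= [in RHS](bigD1 j)/=; last by rewrite jm eq_sym.
  rewrite y'i y'j !mulrA; congr (_ * _).
    by rewrite mulrAC divfK ?gt_eqF// mulrC mulrC -mulrA; congr (_ * _).
  by apply: eq_bigr => l /andP[/andP[_ li] lj]; rewrite y'l.
Qed.

(** Young's inequality for the conjugate exponents [t^-1] and [(1 - t)^-1], applied to [a^t] and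
    [b^(1-t)]. *)
Lemma young_powR (t a b : R) : 0 < t < 1 -> 0 <= a -> 0 <= b ->
  a `^ t * b `^ (1 - t) <= t * a + (1 - t) * b.
Proof.
move=> /andP[t0 t1] a0 b0.
have t1' : 0 < 1 - t by lra.
have := @conjugate_powR R (a `^ t) (b `^ (1 - t)) t^-1 (1 - t)^-1.
rewrite !invr_gt0 !invrK -!powRrM !divff ?gt_eqF// !powRr1//.
rewrite ![_ * t]mulrC ![_ * (1 - t)]mulrC; apply; rewrite ?powR_ge0//.
by rewrite addrC subrK.
Qed.

(** After division of [x] by [Phi x] and of [y] by [Phi y], [young_powR] bounds each coordinate by
    that of a convex combination of two vectors of gauge 1. *)
Lemma gauge_hoelder (t : R) x y : 0 < t < 1 ->
  (forall i, 0 <= x 0 i) -> (forall i, 0 <= y 0 i) ->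
  Phi (\row_i (x 0 i `^ t * y 0 i `^ (1 - t)))
    <= Phi x `^ t * Phi y `^ (1 - t).
Proof.
move=> t01 x0 y0; have /andP[t0 t1] := t01.
have t1' : 0 < 1 - t by lra.
have gauge_eq0 z : Phi z = 0 -> z = 0 by case: gPhi => -[/(_ z)].
have [/gauge_eq0 x00|Px] := eqVneq (Phi x) 0.
  rewrite (_ : \row_i _ = 0) ?gauge0 ?mulr_ge0 ?powR_ge0//.
  by apply/rowP => i; rewrite x00 !mxE powR0 ?gt_eqF// mul0r.
have [/gauge_eq0 y00|Py] := eqVneq (Phi y) 0.
  rewrite (_ : \row_i _ = 0) ?gauge0 ?mulr_ge0 ?powR_ge0//.
  by apply/rowP => i; rewrite y00 !mxE [0 `^ (1 - t)]powR0 ?gt_eqF// mulr0.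
have {}Px : 0 < Phi x by rewrite lt_def Px gauge_ge0.
have {}Py : 0 < Phi y by rewrite lt_def Py gauge_ge0.
set c := _ * _.
have c0 : 0 < c by rewrite mulr_gt0// powR_gt0.
apply: (@le_trans _ _ (Phi (c *: ((t / Phi x) *: x + ((1 - t) / Phi y) *: y)))).
  apply: gauge_le => j; rewrite !mxE mulr_ge0 ?powR_ge0//= -ler_pdivrMl//.
  have xP := divr_ge0 (x0 j) (ltW Px); have yP := divr_ge0 (y0 j) (ltW Py).
  have xE : x 0 j `^ t = (x 0 j / Phi x) `^ t * Phi x `^ t.
    by rewrite -powRM ?(ltW Px)// divfK// gt_eqF.
  have yE : y 0 j `^ (1 - t) = (y 0 j / Phi y) `^ (1 - t) * Phi y `^ (1 - t).
    by rewrite -powRM ?(ltW Py)// divfK// gt_eqF.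
  rewrite xE yE mulrACA -/c mulrC mulfK ?gt_eqF//.
  by rewrite -!mulrA ![_^-1 * _]mulrC young_powR.
rewrite gaugeZ gtr0_norm// -[leRHS]mulr1 ler_pM2l//.
apply: le_trans (gauge_leD _ _) _.
rewrite !gaugeZ !gtr0_norm ?divr_gt0// !divfK ?gt_eqF//.
by lra.
Qed.

End SymmetricGauge.

(** * Horn's inequality *)

(** In the Leibniz formula for [A *m B], the product of sums is expanded over all index functions,
    injective or not. *)
Lemma det_mulmx_ffun (F : comNzRingType) k n (A : 'M[F]_(k, n))
    (B : 'M[F]_(n, k)) :
  \det (A *m B) = \sum_(f : {ffun 'I_k -> 'I_n})
    (\prod_i A i (f i)) * \det (rowsub f B).
Proof.
under eq_bigr do rewrite mulr_sumr.
rewrite exchange_big /=; apply: eq_bigr => s _.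
rewrite (eq_bigr (fun i => \sum_j A i j * B j (s i))); last first.
  by move=> i _; rewrite mxE.
rewrite bigA_distr_bigA mulr_sumr; apply: eq_bigr => f _ /=.
rewrite big_split /= mulrCA; congr (_ * (_ * _)).
by apply: eq_bigr => i _; rewrite mxE.
Qed.

(* Summing over all index functions, instead of over the [k]-subsets, counts
   each minor [k!] times. *)
Lemma cauchy_binet_ffun (F : comNzRingType) k n (A : 'M[F]_(k, n))
    (B : 'M[F]_(n, k)) :
  k`!%:R * \det (A *m B) = \sum_(f : {ffun 'I_k -> 'I_n})
    \det (colsub f A) * \det (rowsub f B).
Proof.
have comp_bij (s : 'S_k) :
    bijective (fun f : {ffun 'I_k -> 'I_n} => [ffun i => f (s i)]).
  exists (fun f : {ffun 'I_k -> 'I_n} => [ffun i => f ((s^-1)%g i)]) => f;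
    by apply/ffunP => i; rewrite !ffunE ?permKV ?permK.
(* Reindexing by [s] permutes the rows of the minor of [B] and produces the sign; the sum over all
   [s] then assembles the Leibniz formula of [colsub f A]. *)
have perm_sum (s : 'S_k) : \det (A *m B) = \sum_(f : {ffun 'I_k -> 'I_n})
    ((-1) ^+ s * \prod_i A i (f (s i))) * \det (rowsub f B).
  rewrite det_mulmx_ffun (reindex _ (onW_bij _ (comp_bij s))) /=.
  apply: eq_bigr => f _.
  rewrite (_ : rowsub _ B = row_perm s (rowsub f B)); last first.
    by apply/matrixP => i j; rewrite !mxE ffunE.
  rewrite row_permE det_mulmx det_perm mulrCA mulrA.
  by congr (_ * _ * _); apply: eq_bigr => i _; rewrite ffunE.
rewrite -{1}(card_Sn k) -cardsT -sum1_card natr_sum mulr_suml.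
under eq_bigr => s _ do rewrite mul1r (perm_sum s).
rewrite (eq_bigl xpredT) => [|s]; last by rewrite inE.
rewrite exchange_big /=; apply: eq_bigr => f _.
rewrite -mulr_suml; congr (_ * _); apply: eq_bigr => s _; congr (_ * _).
by apply: eq_bigr => i _; rewrite mxE.
Qed.

Lemma det_colsub_eq0 (F : comNzRingType) k n (A : 'M[F]_(k, n))
    (f : 'I_k -> 'I_n) : ~ injective f -> \det (colsub f A) = 0.
Proof.
move=> /injectiveP/injectivePn[i [j ij fij]].
rewrite -det_tr; apply: (determinant_alternate ij) => l.
by rewrite !mxE fij.
Qed.

(** The common part of the image [S] of [f] and of the set [T] of leading indices cancels; the
    remainders have equal size, and the smallest leading value [c] separates the values of [d] on
    them. *)
Lemma prod_injective_le (R : realDomainType) k n (kn : (k <= n)%N)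
    (d : 'I_n -> R) (f : 'I_k -> 'I_n) :
  (forall i, 0 <= d i) -> (forall i j : 'I_n, (i <= j)%N -> d j <= d i) ->
  injective f -> \prod_i d (f i) <= \prod_i d (widen_ord kn i).
Proof.
move=> d0 ds finj; case: k kn f finj => [|k] kn f finj.
  by rewrite !big_ord0.
pose S := [set f i | i : 'I_k.+1].
pose T := [set i : 'I_n | (i <= k)%N].
have cardS : #|S| = k.+1 by rewrite card_imset ?card_ord.
have prodT : \prod_i d (widen_ord kn i) = \prod_(i in T) d i.
  rewrite [RHS](eq_bigl (fun i : 'I_n => (i < k.+1)%N)) => [|i]; last first.
    by rewrite inE ltnS.
  by rewrite (big_ord_narrow kn).
have cardT : #|T| = k.+1.
  by rewrite -sum1_card (eq_bigl (fun i : 'I_n => (i < k.+1)%N)) => [|i];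
    rewrite ?inE// (big_ord_narrow kn) sum1_card card_ord.
have -> : \prod_i d (f i) = \prod_(i in S) d i.
  by rewrite big_imset//= => i j _ _; apply: finj.
rewrite prodT [leLHS](big_setID T) [leRHS](big_setID S) /=.
rewrite [T :&: S]finset.setIC.
pose c := d (widen_ord kn ord_max).
apply: ler_wpM2l; first by apply: prodr_ge0.
have SD : \prod_(i in S :\: T) d i <= c ^+ #|S :\: T|.
  rewrite -prodr_const; apply: ler_prod => i.
  by rewrite !inE -ltnNge d0 => /andP[/ltnW ki _]; apply: ds.
have TD : c ^+ #|T :\: S| <= \prod_(i in T :\: S) d i.
  rewrite -prodr_const; apply: ler_prod => i.
  by rewrite !inE d0 => /andP[_ ik]; apply: ds.
by apply: le_trans SD _; rewrite cardsD cardS finset.setIC -cardT -cardsD.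
Qed.

Local Open Scope sesquilinear_scope.
Local Open Scope complex_scope.

Section Horn.
Variable R : realType.
Local Notation C := R[i].

Definition real_diag_mx n (d : 'rV[R]_n) : 'M[C]_n :=
  diag_mx (map_mx (real_complex R) d).

Definition nonneg_sorted n (d : 'rV[R]_n) : Prop :=
  (forall i, 0 <= d 0 i) /\ (forall i j : 'I_n, (i <= j)%N -> d 0 j <= d 0 i).

Lemma trmxC_mul m n p (A : 'M[C]_(m, n)) (B : 'M[C]_(n, p)) :
  (A *m B)^t* = B^t* *m A^t*.
Proof. by rewrite trmx_mul map_mxM. Qed.

Lemma det_real_diag n (d : 'rV[R]_n) :
  \det (real_diag_mx d) = (\prod_i d 0 i)%:C.
Proof.
by rewrite det_diag rmorph_prod; apply: eq_bigr => i _; rewrite mxE.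
Qed.

(** Up to the factor [k!], both determinants are sums of [|det (colsub f W)|^2] over index functions
    [f], with weights [prod_i d (f i)] on the left. The terms with [f] not injective vanish;
    [prod_injective_le] bounds the other weights. *)
Lemma det_compression_diag_le k n (kn : (k <= n)%N) (W : 'M[C]_(k, n))
    (d : 'rV[R]_n) : nonneg_sorted d ->
  \det (W *m real_diag_mx d *m W^t*)
    <= (\prod_(i < k) d 0 (widen_ord kn i))%:C * \det (W *m W^t*).
Proof.
move=> [d0 ds].
have k0 : 0 < k`!%:R :> C by rewrite ltr0n fact_gt0.
rewrite -(ler_pM2l k0) mulrCA -mulmxA !cauchy_binet_ffun mulr_sumr.
apply: ler_sum => f _.
have -> : rowsub f (real_diag_mx d *m W^t*) =
    real_diag_mx (\row_i d 0 (f i)) *m rowsub f (W^t*).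
  by apply/matrixP => i j; rewrite !mul_diag_mx !mxE.
have -> : rowsub f (W^t*) = (colsub f W)^t*.
  by apply/matrixP => i j; rewrite !mxE.
rewrite det_mulmx det_real_diag det_map_mx det_tr mulrCA -normCK.
have [/injectiveP finj|/injectiveP finj] := boolP (injectiveb f); last first.
  by rewrite det_colsub_eq0// normr0 expr0n !mulr0.
rewrite ler_wpM2r ?exprn_ge0// lecR.
rewrite (eq_bigr (fun i => d 0 (f i))) => [|i _]; last by rewrite mxE.
exact: (@prod_injective_le _ _ _ kn (d 0)).
Qed.

Lemma det_compression_le k n (kn : (k <= n)%N) (W : 'M[C]_(k, n))
    (U : 'M[C]_n) (d : 'rV[R]_n) : U \is unitarymx -> nonneg_sorted d ->
  \det (W *m (U^t* *m real_diag_mx d *m U) *m W^t*)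
    <= (\prod_(i < k) d 0 (widen_ord kn i))%:C * \det (W *m W^t*).
Proof.
move=> Uu ds; have := det_compression_diag_le kn (W *m U^t*) ds.
by rewrite !trmxC_mul trmxCK !mulmxA mulmxKtV.
Qed.

(** The first [k] rows [W] of [Uv] compress [Y^* P Y] to a diagonal matrix whose determinant is the
    product of the [v_i]. Compressing [P] by [W Y^*] splits off the [a_i], and compressing [Y^* Y]
    by [W] the [b_i]. *)
Lemma horn_inequality k n (kn : (k <= n)%N) (P Y Ua Ub Uv : 'M[C]_n)
    (a b v : 'rV[R]_n) :
  Ua \is unitarymx -> Ub \is unitarymx -> Uv \is unitarymx ->
  nonneg_sorted a -> nonneg_sorted b ->
  P = Ua^t* *m real_diag_mx a *m Ua ->
  Y^t* *m Y = Ub^t* *m real_diag_mx b *m Ub ->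
  Y^t* *m P *m Y = Uv^t* *m real_diag_mx v *m Uv ->
  \prod_(i < k) v 0 (widen_ord kn i)
    <= \prod_(i < k) (a 0 (widen_ord kn i) * b 0 (widen_ord kn i)).
Proof.
move=> uUa uUb uUv as_ bs PE YE vE.
pose W := rowsub (widen_ord kn) Uv.
have WE : W = rowsub (widen_ord kn) 1%:M *m Uv.
  by rewrite mul_rowsub_mx mul1mx.
have WWE : W *m W^t* = 1%:M.
  apply/matrixP => i j; have /matrixP/(_ (widen_ord kn i) (widen_ord kn j)) :=
    unitarymxP uUv.
  by rewrite !mxE => H; rewrite -[RHS]H; apply: eq_bigr => l _; rewrite !mxE.
have WvW : W *m (Y^t* *m P *m Y) *m W^t* =
    real_diag_mx (\row_i v 0 (widen_ord kn i)).
  rewrite vE WE trmxC_mul !mulmxA mulmxtVK// mulmxtVK//.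
  apply/matrixP => i j.
  rewrite -mulmxA mul_rowsub_mx mul1mx mul_diag_mx !mxE eq_sym.
  by rewrite conjC_nat -(inj_eq val_inj) mulr_natr.
have WYP : W *m (Y^t* *m P *m Y) *m W^t* = (W *m Y^t*) *m P *m (W *m Y^t*)^t*.
  by rewrite trmxC_mul trmxCK !mulmxA.
have WYY : (W *m Y^t*) *m (W *m Y^t*)^t* = W *m (Y^t* *m Y) *m W^t*.
  by rewrite trmxC_mul trmxCK !mulmxA.
have := det_compression_le kn (W *m Y^t*) uUa as_.
rewrite -PE -WYP WvW det_real_diag WYY => /le_trans.
have := det_compression_le kn W uUb bs; rewrite -YE WWE det1 mulr1 => YYle.
have a0 : 0 <= \prod_(i < k) a 0 (widen_ord kn i).
  by apply: prodr_ge0 => i _; case: as_.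
have {}YYle :=
  ler_wpM2l (_ : 0 <= (\prod_(i < k) a 0 (widen_ord kn i))%:C) YYle.
move/(_ _ (YYle _)); rewrite lecR => /(_ a0).
rewrite -rmorphM lecR -big_split /=.
by congr (_ <= _); apply: eq_bigr => i _; rewrite mxE.
Qed.

End Horn.

(** * Spectra and functional calculus *)

Section Spectrum.
Variable R : realType.
Local Notation C := R[i].

(** The characteristic polynomial records the eigenvalues with multiplicity but without order, and
    it is unchanged when the factors of a product are exchanged. *)
Definition has_spectrum n (H : 'M[C]_n) (d : 'rV[R]_n) : Prop :=
  char_poly H = \prod_i ('X - (d 0 i)%:C%:P).

Lemma char_poly_mulmxC n (A B : 'M[C]_n) : A \in unitmx ->
  char_poly (A *m B) = char_poly (B *m A).
Proof.
move=> Au; have comm : char_poly_mx (A *m B) *m map_mx polyC A =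
    map_mx polyC A *m char_poly_mx (B *m A).
  rewrite /char_poly_mx !map_mxM mulmxBl mulmxBr scalar_mxC.
  by rewrite !mulmxA.
have /eqP := congr1 determinant comm.
rewrite !det_mulmx [X in _ == X]mulrC det_map_mx => /eqP /mulIf; apply.
by rewrite polyC_eq0 -unitfE -unitmxE.
Qed.

Lemma has_spectrum_mulmxC n (A B : 'M[C]_n) d : A \in unitmx ->
  has_spectrum (A *m B) d <-> has_spectrum (B *m A) d.
Proof. by move=> Au; rewrite /has_spectrum char_poly_mulmxC. Qed.

Lemma has_spectrum_unitary n (U : 'M[C]_n) d : U \is unitarymx ->
  has_spectrum (U^t* *m real_diag_mx d *m U) d.
Proof.
move=> Uu; apply: (has_spectrum_mulmxC _ _ (unitarymx_unit Uu)).1.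
rewrite mulmxA (unitarymxP Uu) mul1mx /has_spectrum char_poly_trig.
  by apply: eq_bigr => i _; rewrite !mxE eqxx.
by apply/is_trig_mxP => i j ij; rewrite !mxE -(inj_eq val_inj) ltn_eqF.
Qed.

Lemma has_spectrum_perm n (H : 'M[C]_n) d e : has_spectrum H d ->
  has_spectrum H e -> exists s : 'S_n, forall i, e 0 i = d 0 (s i).
Proof.
move=> Hd; rewrite /has_spectrum Hd => de.
have /prod_XsubC_eq : \prod_(x <- [tuple (e 0 i)%:C | i < n]) ('X - x%:P) =
    \prod_(x <- [tuple (d 0 i)%:C | i < n]) ('X - x%:P).
  rewrite !big_tuple; under eq_bigr do rewrite tnth_mktuple.
  by rewrite -de; apply: eq_bigr => i _; rewrite tnth_mktuple.
move=> /tuple_permP[s sE]; exists s => i.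
have /(congr1 (fun l => nth 0 l i)) := sE.
rewrite -!tnth_nth !tnth_mktuple; exact: complexI.
Qed.

(** Expresses sorting as a permutation of coordinates, under which gauge functions are invariant and
    by which the rows of a unitary matrix can be rearranged. *)
Lemma sort_row n (d : 'rV[R]_n) : exists s : 'S_n,
  [/\ forall i j : 'I_n, (i <= j)%N -> d 0 (s j) <= d 0 (s i) &
      forall i : 'I_n, nth 0 (sort >=%R [seq d 0 j | j : 'I_n]) i = d 0 (s i)].
Proof.
set l := [seq d 0 j | j : 'I_n]; set sl := sort _ l.
have /tuple_permP[s sE] : perm_eq sl [tuple d 0 i | i < n].
  by rewrite perm_sort.
have nthE (i : 'I_n) : nth 0 sl i = d 0 (s i).
  by rewrite sE -tnth_nth !tnth_mktuple.
exists s; split=> // i j ij; rewrite -!nthE.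
have sz : size sl = n by rewrite size_sort size_map -cardE card_ord.
have trans : transitive (>=%R : rel R) by move=> x y z /[swap]; apply: le_trans.
apply: (sorted_leq_nth trans) => //; rewrite ?inE ?sz//.
  by move=> x; apply: le_refl.
by apply: (@sort_sorted _ >=%R) => x y; apply: le_total.
Qed.

Lemma hermitian_spectral n (H : 'M[C]_n) : H^t* = H ->
  H = (spectralmx H)^t*
      *m real_diag_mx (\row_i complex.Re (spectral_diag H 0 i))
      *m spectralmx H.
Proof.
move=> HH; have Hh : H \is hermsymmx.
  by apply/is_hermitianmxP; rewrite expr0 scale1r.
have /mxOverP Hr := hermitian_spectral_diag_real Hh.
have -> : real_diag_mx (\row_i complex.Re (spectral_diag H 0 i)) =
    diag_mx (spectral_diag H).
  by congr diag_mx; apply/rowP => i; rewrite !mxE (RRe_real (Hr 0 i)).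
rewrite -(invmx_unitary (spectral_unitarymx H)).
exact/orthomx_spectralP/hermitian_normalmx.
Qed.

Lemma has_spectrum_spectral_diag n (H : 'M[C]_n) : H^t* = H ->
  has_spectrum H (\row_i complex.Re (spectral_diag H 0 i)).
Proof.
move=> /hermitian_spectral {1}->.
by apply: has_spectrum_unitary; apply: spectral_unitarymx.
Qed.

Lemma hermitian_sorted_spectral n (H : 'M[C]_n) : H^t* = H ->
  exists (U : 'M[C]_n) (d : 'rV[R]_n), [/\ U \is unitarymx,
    forall i j : 'I_n, (i <= j)%N -> d 0 j <= d 0 i &
    H = U^t* *m real_diag_mx d *m U].
Proof.
move=> HH; set P := spectralmx H.
set d := \row_i complex.Re (spectral_diag H 0 i).
have Pu : P \is unitarymx by apply: spectral_unitarymx.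
have [s [ds _]] := sort_row d.
pose U := rowsub s P; exists U, (\row_i d 0 (s i)).
have UXU X : U *m X *m U^t* = mxsub s s (P *m X *m P^t*).
  apply/matrixP => i j; rewrite mul_rowsub_mx !mxE.
  by apply: eq_bigr => l _; rewrite !mxE.
have Uu : U \is unitarymx.
  apply/unitarymxP; have := UXU 1%:M; rewrite !mulmx1 => ->.
  rewrite (unitarymxP Pu); apply/matrixP => i j.
  by rewrite !mxE (inj_eq perm_inj).
split=> // [i j ij|]; first by rewrite mxE [leRHS]mxE; apply: ds.
have -> : real_diag_mx (\row_i d 0 (s i)) = U *m H *m U^t*.
  rewrite UXU [in RHS](hermitian_spectral HH) -/P -/d !mulmxA.
  rewrite (unitarymxP Pu) mul1mx mulmxtVK//.
  by apply/matrixP => i j; rewrite !mxE (inj_eq perm_inj).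
by rewrite !mulmxA mulmxKtV// (mulmx1C (unitarymxP Uu)) mul1mx.
Qed.

(** * Gram matrices and positive definiteness *)

Lemma gramE n (T : 'M[C]_n) (u : 'cV[C]_n) :
  (u^t* *m (T^t* *m T) *m u) 0 0 = \sum_i `|(T *m u) i 0| ^+ 2.
Proof.
rewrite mulmxA -trmxC_mul -mulmxA mxE; apply: eq_bigr => i _.
by rewrite normCK mulrC !mxE.
Qed.

Lemma gram_herm n (T : 'M[C]_n) : (T^t* *m T)^t* = T^t* *m T.
Proof. by rewrite trmxC_mul trmxCK. Qed.

Lemma posdefmx_gram n (T : 'M[C]_n) : T \in unitmx ->
  posdefmx (T^t* *m T).
Proof.
move=> Tu; split.
  by apply/is_hermitianmxP; rewrite expr0 scale1r gram_herm.
move=> u u0; rewrite gramE lt_def sumr_ge0 ?andbT => [|i _]; last first.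
  by rewrite exprn_ge0.
apply: contra_neq u0 => /eqP; rewrite psumr_eq0 => [/allP Tu0|i _]; last first.
  by rewrite exprn_ge0.
rewrite -(mulKmx Tu u) (_ : T *m u = 0) ?mulmx0//.
apply/colP => i; have := Tu0 i (mem_index_enum i).
by rewrite expf_eq0 normr_eq0 => /eqP ->; rewrite mxE.
Qed.

(** The vector [u] is a unit eigenvector for [d_i]; this passes the sign of the quadratic form on to
    the eigenvalues. *)
Lemma form_spectrum n (H U : 'M[C]_n) d i (u := col i (U^t*)) :
  U \is unitarymx -> H = U^t* *m real_diag_mx d *m U ->
  u != 0 /\ (u^t* *m H *m u) 0 0 = (d 0 i)%:C.
Proof.
move=> Uu HE; have Uui : U *m u = col i 1%:M.
  by rewrite /u !colE mulmxA (unitarymxP Uu).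
split.
  apply/eqP => u0; have := Uui; rewrite u0 mulmx0 => /colP/(_ i).
  by rewrite !mxE eqxx => /eqP; rewrite eq_sym oner_eq0.
rewrite HE !mulmxA -trmxC_mul -!mulmxA Uui mxE (bigD1 i)//= big1 => [|j ji].
  by rewrite mul_diag_mx !mxE eqxx conjC1 mul1r mulr1 addr0.
by rewrite !mxE (negbTE ji) conjC0 mul0r.
Qed.

Lemma gram_sorted_spectral n (T : 'M[C]_n) :
  exists (U : 'M[C]_n) (d : 'rV[R]_n), [/\ U \is unitarymx,
    nonneg_sorted d & T^t* *m T = U^t* *m real_diag_mx d *m U].
Proof.
have [U [d [Uu ds TE]]] := hermitian_sorted_spectral (gram_herm T).
exists U, d; split=> //; split=> // i.
have [_] := form_spectrum i Uu TE.
by rewrite gramE -(lecR 0) => <-; apply: sumr_ge0 => j _; rewrite exprn_ge0.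
Qed.

Lemma posdefmx_herm n (A : 'M[C]_n) : posdefmx A -> A^t* = A.
Proof. by case=> /is_hermitianmxP; rewrite expr0 scale1r => <-. Qed.

Lemma posdefmx_spectral_diag_gt0 n (A : 'M[C]_n) i : posdefmx A ->
  0 < complex.Re (spectral_diag A 0 i).
Proof.
move=> Apd; have AE := hermitian_spectral (posdefmx_herm Apd).
have [u0] := form_spectrum i (spectral_unitarymx A) AE.
by move=> dE; have := Apd.2 _ u0; rewrite dE ltcR mxE.
Qed.

(** * Real powers of matrices *)

Lemma mxpowRE n (A : 'M[C]_n) (r : R) :
  mxpowR A r = (spectralmx A)^t*
      *m real_diag_mx (\row_i complex.Re (spectral_diag A 0 i) `^ r)
      *m spectralmx A.
Proof.
rewrite /mxpowR (invmx_unitary (spectral_unitarymx A)).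
rewrite (_ : diag_mx _ =
  real_diag_mx (\row_i complex.Re (spectral_diag A 0 i) `^ r))//.
by congr diag_mx; apply/rowP => i; rewrite !mxE.
Qed.

Lemma real_diag_mx_herm n (d : 'rV[R]_n) : (real_diag_mx d)^t* = real_diag_mx d.
Proof.
rewrite /real_diag_mx tr_diag_mx map_diag_mx; congr diag_mx.
by apply/rowP => i; rewrite !mxE; apply: conjc_real.
Qed.

Lemma real_diag_mxM n (d e : 'rV[R]_n) :
  real_diag_mx d *m real_diag_mx e = real_diag_mx (\row_i (d 0 i * e 0 i)).
Proof.
by rewrite mulmx_diag; congr diag_mx; apply/rowP => i; rewrite !mxE rmorphM.
Qed.

Lemma mulmx_unitary_diag n (U : 'M[C]_n) (d e : 'rV[R]_n) :
  U \is unitarymx ->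
  (U^t* *m real_diag_mx d *m U) *m (U^t* *m real_diag_mx e *m U) =
  U^t* *m real_diag_mx (\row_i (d 0 i * e 0 i)) *m U.
Proof.
by move=> Uu; rewrite -real_diag_mxM !mulmxA (mulmxtVK _ Uu).
Qed.

Lemma mxpowR_herm n (A : 'M[C]_n) r : (mxpowR A r)^t* = mxpowR A r.
Proof. by rewrite mxpowRE !trmxC_mul trmxCK real_diag_mx_herm mulmxA. Qed.

Lemma mxpowR0 n (A : 'M[C]_n) : mxpowR A 0 = 1%:M.
Proof.
rewrite mxpowRE (_ : real_diag_mx _ = 1%:M); last first.
  by apply/matrixP => i j; rewrite !mxE powRr0.
by rewrite mulmx1 (mulmx1C (unitarymxP (spectral_unitarymx A))).
Qed.

Lemma mxpowR1 n (A : 'M[C]_n) : posdefmx A -> mxpowR A 1 = A.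
Proof.
move=> Apd; rewrite mxpowRE [RHS](hermitian_spectral (posdefmx_herm Apd)).
rewrite (_ : \row_i (_ `^ 1) = \row_i complex.Re (spectral_diag A 0 i))//.
apply/rowP => i; by rewrite !mxE powRr1// ltW// posdefmx_spectral_diag_gt0.
Qed.

Lemma mxpowRD n (A : 'M[C]_n) x y : posdefmx A ->
  mxpowR A x *m mxpowR A y = mxpowR A (x + y).
Proof.
move=> Apd; rewrite !mxpowRE.
have := spectral_unitarymx A; move: (spectralmx A) => U Uu.
rewrite (mulmx_unitary_diag _ _ Uu) (_ : \row_i (_ * _) =
  \row_i complex.Re (spectral_diag A 0 i) `^ (x + y))//.
apply/rowP => i; rewrite !mxE -powRD//.
by apply/implyP => _; rewrite gt_eqF// posdefmx_spectral_diag_gt0.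
Qed.

Lemma mxpowRN n (A : 'M[C]_n) x : posdefmx A ->
  mxpowR A x *m mxpowR A (- x) = 1%:M.
Proof. by move=> Apd; rewrite mxpowRD// subrr mxpowR0. Qed.

Lemma mxpowR_unit n (A : 'M[C]_n) x : posdefmx A -> mxpowR A x \in unitmx.
Proof.
move=> Apd; have := mxpowRN x Apd; move: (mxpowR A (- x)) => B.
by case/mulmx1_unit.
Qed.

End Spectrum.

(** * Symmetric norms in terms of eigenvalues *)

Section SymmetricNorm.
Variables (R : realType) (n : nat) (N : 'M[R[i]]_n.+1 -> R).
Variable Phi : 'rV[R]_n.+1 -> R.
Hypothesis gPhi : symmetric_gauge Phi.
Hypothesis NPhi : forall A, N A = Phi (singular_values A).

(** By permutation invariance of [Phi] the eigenvalues may be listed in any order, although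
    [singular_values] sorts them. *)
Lemma norm_spectrum (A : 'M[R[i]]_n.+1) d :
  has_spectrum (A^t* *m A) d -> N A = Phi (\row_i Num.sqrt (d 0 i)).
Proof.
move=> Ad; have AA := gram_herm A.
have [s sE] := has_spectrum_perm Ad (has_spectrum_spectral_diag AA).
rewrite NPhi -[RHS](gauge_perm gPhi s).
pose e := \row_j Num.sqrt (complex.Re (spectral_diag (A^t* *m A) 0 j)).
have [s' [_ s'E]] := sort_row e.
rewrite (_ : singular_values A = \row_i e 0 (s' i)).
  rewrite [LHS](gauge_perm gPhi); congr Phi; apply/rowP => i.
  by rewrite !mxE -sE mxE.
apply/rowP => i; rewrite mxE [RHS]mxE -s'E.
by congr (nth 0 (sort _ _) i); apply: eq_map => j; rewrite mxE.
Qed.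

Lemma norm_mxpowR (H : 'M[R[i]]_n.+1) d r : H^t* = H -> has_spectrum H d ->
  (forall i, 0 <= d 0 i) -> N (mxpowR H r) = Phi (\row_i (d 0 i `^ r)).
Proof.
move=> HH Hd d0; have Uu := spectral_unitarymx H.
have [s sE] := has_spectrum_perm Hd (has_spectrum_spectral_diag HH).
(* The power is Hermitian, so its Gram matrix has the squared powers as eigenvalues. *)
rewrite (@norm_spectrum _
  (\row_i (complex.Re (spectral_diag H 0 i) `^ r) ^+ 2)).
  rewrite -[RHS](gauge_perm gPhi s); congr Phi; apply/rowP => i.
  by rewrite !mxE sqrtr_sqr ger0_norm ?powR_ge0// -sE mxE.
rewrite mxpowR_herm mxpowRE; move: (spectralmx H) Uu => U Uu.
rewrite (mulmx_unitary_diag _ _ Uu).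
rewrite (_ : \row_i (_ * _) =
  \row_i (complex.Re (spectral_diag H 0 i) `^ r) ^+ 2).
  exact: has_spectrum_unitary.
by apply/rowP => i; rewrite !mxE.
Qed.

End SymmetricNorm.

(** * Hoelder's inequality for symmetric norms *)

Section NormHoelder.
Variables (R : realType) (n : nat) (N : 'M[R[i]]_n.+1 -> R).
Variable Phi : 'rV[R]_n.+1 -> R.
Hypothesis gPhi : symmetric_gauge Phi.
Hypothesis NPhi : forall A, N A = Phi (singular_values A).

(** With [x = a^(u/t)] and [y = b^(u/(1-t))] one has [x^t y^(1-t) = (a b)^u]. This weakly
    log-majorizes [v^u], so [gauge_hoelder] finishes. *)
Lemma gauge_log_majorization_hoelder (v a b : 'rV[R]_n.+1) (t u : R) :
  0 < t < 1 -> 0 < u -> nonneg_sorted v -> nonneg_sorted a ->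
  nonneg_sorted b ->
  (forall k (kn : (k <= n.+1)%N), \prod_(i < k) v 0 (widen_ord kn i)
    <= \prod_(i < k) (a 0 (widen_ord kn i) * b 0 (widen_ord kn i))) ->
  Phi (\row_i v 0 i `^ u)
    <= Phi (\row_i a 0 i `^ (u / t)) `^ t
       * Phi (\row_i b 0 i `^ (u / (1 - t))) `^ (1 - t).
Proof.
move=> t01 u0 [v0 vs] [a0 _] [b0 _] vab; have /andP[t0 t1] := t01.
have t1' : 0 < 1 - t by lra.
pose x := \row_i a 0 i `^ (u / t); pose y := \row_i b 0 i `^ (u / (1 - t)).
have [x0 y0] : (forall i, 0 <= x 0 i) /\ (forall i, 0 <= y 0 i).
  by split=> i; rewrite mxE powR_ge0.
apply: le_trans (gauge_hoelder gPhi t01 x0 y0).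
apply: (gauge_weak_log_majorization gPhi) => [i|i|i j ij|m].
- by rewrite mxE powR_ge0.
- by rewrite mxE mulr_ge0 ?powR_ge0.
- by rewrite !mxE ge0_ler_powR ?nnegrE ?vs ?(ltW u0).
have prod_powR (F : 'I_n.+1 -> R) : (forall i, 0 <= F i) ->
    \prod_(l < n.+1 | (l <= m)%N) F l `^ u =
    (\prod_(l < n.+1 | (l <= m)%N) F l) `^ u.
  (* Nonnegativity of the partial products is carried along because [powRM] requires it. *)
  move=> F0; apply: (@proj1 _ (0 <= \prod_(l < n.+1 | (l <= m)%N) F l)).
  apply: (big_ind2 (fun X Y => X = Y `^ u /\ 0 <= Y)).
  - by rewrite powR1.
  - by move=> _ X _ Y [-> X0] [-> Y0]; rewrite powRM// mulr_ge0.
  - by move=> i _.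
under eq_bigr do rewrite mxE.
under [leRHS]eq_bigr do rewrite !mxE -!powRrM !divfK ?gt_eqF// -powRM//.
rewrite (prod_powR (v 0))// (prod_powR (fun i => a 0 i * b 0 i)) => [|i].
  rewrite ge0_ler_powR ?nnegrE ?(ltW u0) ?prodr_ge0// => [i _|].
    by rewrite mulr_ge0.
  have narrow (F : 'I_n.+1 -> R) : \prod_(l < n.+1 | (l <= m)%N) F l =
      \prod_(i < m.+1) F (widen_ord (ltn_ord m) i).
    rewrite (eq_bigl (fun l : 'I_n.+1 => (l < m.+1)%N)) => [|l].
      by rewrite (big_ord_narrow (ltn_ord m)).
    by rewrite ltnS.
  by rewrite !narrow.
by rewrite mulr_ge0.
Qed.

Lemma norm_mxpowR_hoelder (X Y : 'M[R[i]]_n.+1) (t u : R) :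
  0 < t < 1 -> 0 < u ->
  N (mxpowR ((X *m Y)^t* *m (X *m Y)) u)
    <= N (mxpowR (X^t* *m X) (u / t)) `^ t
       * N (mxpowR (Y^t* *m Y) (u / (1 - t))) `^ (1 - t).
Proof.
move=> t01 u0.
have gram_norm (T U : 'M[R[i]]_n.+1) d r : U \is unitarymx ->
    nonneg_sorted d -> T^t* *m T = U^t* *m real_diag_mx d *m U ->
    N (mxpowR (T^t* *m T) r) = Phi (\row_i d 0 i `^ r).
  move=> Uu [d0 _] TE; apply: (norm_mxpowR gPhi NPhi _ (gram_herm T)) => //.
  by rewrite TE; apply: has_spectrum_unitary.
have [Ua [a [uUa sa aE]]] := gram_sorted_spectral X.
have [Ub [b [uUb sb bE]]] := gram_sorted_spectral Y.
have [Uv [v [uUv sv vE]]] := gram_sorted_spectral (X *m Y).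
rewrite [leLHS](gram_norm _ _ _ _ uUv sv vE).
rewrite [X in _ <= X `^ _ * _](gram_norm _ _ _ _ uUa sa aE).
rewrite [X in _ <= _ * X `^ _](gram_norm _ _ _ _ uUb sb bE).
apply: gauge_log_majorization_hoelder => // k kn.
apply: (horn_inequality kn uUa uUb uUv sa sb aE bE).
by rewrite -vE trmxC_mul !mulmxA.
Qed.

(** Needed because [right_factor] involves [Y Y^*], whereas Hoelder's inequality produces
    [Y^* Y]. *)
Lemma norm_mxpowR_gramC (Y : 'M[R[i]]_n.+1) r : Y \in unitmx ->
  N (mxpowR (Y *m Y^t*) r) = N (mxpowR (Y^t* *m Y) r).
Proof.
move=> Yu; have [U [d [Uu [d0 _] dE]]] := gram_sorted_spectral Y.
have Yd : has_spectrum (Y^t* *m Y) d by rewrite dE; apply: has_spectrum_unitary.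
have Yd' := (has_spectrum_mulmxC (Y^t*) d Yu).2 Yd.
rewrite [LHS](norm_mxpowR gPhi NPhi _ _ Yd' d0) ?trmxC_mul ?trmxCK//.
by rewrite [RHS](norm_mxpowR gPhi NPhi _ _ Yd d0) ?trmxC_mul ?trmxCK.
Qed.

(** The inverse [G] is [mxpowR H (-1)]. In the reverse inequality this turns the factor [Y^-1] into
    a power of [Y Y^*] with negative exponent. *)
Lemma norm_mxpowR_inv (H G : 'M[R[i]]_n.+1) r : posdefmx H -> H *m G = 1%:M ->
  N (mxpowR G r) = N (mxpowR H (- r)).
Proof.
move=> Hpd HG; have -> : G = mxpowR H (-1).
  have := mxpowRN 1 Hpd; rewrite mxpowR1// => HH.
  by rewrite -[LHS]mul1mx -(mulmx1C HH) -mulmxA HG mulmx1.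
set d := \row_i complex.Re (spectral_diag H 0 i).
have d0 i : 0 <= d 0 i by rewrite mxE ltW// posdefmx_spectral_diag_gt0.
have HH := posdefmx_herm Hpd.
rewrite [RHS](norm_mxpowR gPhi NPhi _ HH (has_spectrum_spectral_diag HH) d0).
have Hd : has_spectrum (mxpowR H (-1)) (\row_i d 0 i `^ (-1)).
  rewrite mxpowRE (_ : \row_i _ = \row_i d 0 i `^ (-1)).
    by apply: has_spectrum_unitary; apply: spectral_unitarymx.
  by apply/rowP => i; rewrite !mxE.
rewrite (norm_mxpowR gPhi NPhi _ (mxpowR_herm H _) Hd) => [|i].
  by congr Phi; apply/rowP => i; rewrite !mxE -powRrM mulN1r.
by rewrite mxE powR_ge0.
Qed.

(** With [W = Y^-1], the Gram matrix [W^* M^* M W] has the spectrum of [M^* M W W^*], and [W W^*],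
    the inverse of [Y^* Y], is diagonal in the same basis [V] as [M^* M]. *)
Lemma gram_quotient_spectrum (M Y V : 'M[R[i]]_n.+1) (d f g : 'rV[R]_n.+1) :
  Y \in unitmx -> V \is unitarymx ->
  M^t* *m M = V^t* *m real_diag_mx d *m V ->
  Y^t* *m Y = V^t* *m real_diag_mx g *m V ->
  (forall i, g 0 i * f 0 i = 1) ->
  has_spectrum ((M *m invmx Y)^t* *m (M *m invmx Y)) (\row_i (d 0 i * f 0 i)).
Proof.
move=> Yu Vu ME YE gf; set W := invmx Y.
have YW : Y *m W = 1%:M by rewrite mulmxV.
have WY : W^t* *m Y^t* = 1%:M by rewrite -trmxC_mul YW trmx1 map_mx1.
have [Wu _] := mulmx1_unit WY.
have WW : W *m W^t* = V^t* *m real_diag_mx f *m V.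
  have YF : (Y^t* *m Y) *m (V^t* *m real_diag_mx f *m V) = 1%:M.
    rewrite YE (mulmx_unitary_diag _ _ Vu) (_ : real_diag_mx _ = 1%:M).
      by rewrite mulmx1 (mulmx1C (unitarymxP Vu)).
    by apply/matrixP => i j; rewrite !mxE gf.
  have WWYY : (W *m W^t*) *m (Y^t* *m Y) = 1%:M.
    by rewrite -mulmxA (mulmxA (W^t*)) WY mul1mx mulVmx.
  move: (W *m W^t*) (Y^t* *m Y) (_ *m V) WWYY YF => P Q F PQ QF.
  by rewrite -[P]mulmx1 -QF mulmxA PQ mul1mx.
have -> : (M *m W)^t* *m (M *m W) = W^t* *m (M^t* *m M *m W).
  by rewrite trmxC_mul !mulmxA.
apply: (has_spectrum_mulmxC _ _ Wu).2.
rewrite -(mulmxA _ W) WW ME (mulmx_unitary_diag _ _ Vu).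
exact: has_spectrum_unitary.
Qed.

Lemma norm_mxpowR_gt0 (H : 'M[R[i]]_n.+1) r : posdefmx H -> 0 < N (mxpowR H r).
Proof.
move=> Hpd; have HH := posdefmx_herm Hpd.
rewrite (norm_mxpowR gPhi NPhi _ HH (has_spectrum_spectral_diag HH)) => [|i].
  apply: (@gauge_gt0 _ _ _ gPhi _ ord0); rewrite !mxE.
  by rewrite gt_eqF// powR_gt0// posdefmx_spectral_diag_gt0.
by rewrite mxE ltW// posdefmx_spectral_diag_gt0.
Qed.

(** For [c = a^t b^(1-t)], the inequality [young_powR] with weight [t^-1], applied to [c] and [b],
    reads [a <= c / t + (1 - t^-1) b]. *)
Lemma young_powR_rev (t a b : R) : 1 < t -> 0 <= a -> 0 < b ->
  t * a + (1 - t) * b <= a `^ t * b `^ (1 - t).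
Proof.
move=> t1 a0 b0; have t0 : 0 < t by lra.
have tV01 : 0 < t^-1 < 1 by rewrite invr_gt0 t0 invf_lt1.
have c0 : 0 <= a `^ t * b `^ (1 - t) by rewrite mulr_ge0 ?powR_ge0.
have := young_powR tV01 c0 (ltW b0).
rewrite powRM ?powR_ge0// -!powRrM divff ?gt_eqF// powRr1//.
rewrite -mulrA -powRD; last first.
  by rewrite (gt_eqF b0) implybT.
have -> : (1 - t) / t + (1 - t^-1) = 0 by field; rewrite gt_eqF.
rewrite powRr0 mulr1 -(ler_pM2l t0) mulrDr !mulrA divff ?gt_eqF// mul1r.
rewrite mulrBr mulr1 divff ?gt_eqF//.
lra.
Qed.

Lemma powR_mul_le (t a b c : R) : 1 < t -> 0 <= a -> 0 < b -> 0 <= c ->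
  a <= c `^ t^-1 * b `^ (1 - t^-1) -> a `^ t * b `^ (1 - t) <= c.
Proof.
move=> t1 a0 b0 c0 ac; have t0 : 0 < t by lra.
have -> : c = (c `^ t^-1 * b `^ (1 - t^-1)) `^ t * b `^ (1 - t).
  rewrite powRM ?powR_ge0// -!powRrM mulVf ?gt_eqF// powRr1// -mulrA -powRD.
    have -> : (1 - t^-1) * t + (1 - t) = 0 by field; rewrite gt_eqF.
    by rewrite powRr0 mulr1.
  by rewrite (gt_eqF b0) implybT.
by rewrite ler_wpM2r ?powR_ge0// ge0_ler_powR ?nnegrE ?(ltW t0)// (le_trans a0).
Qed.

Lemma norm_ge0 (A : 'M[R[i]]_n.+1) : 0 <= N A.
Proof. by rewrite NPhi gauge_ge0. Qed.

Lemma hoelder_quotient (M Y : 'M[R[i]]_n.+1) (t s : R) : Y \in unitmx ->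
  0 < t < 1 -> 0 < s ->
  N (mxpowR (M^t* *m M) s)
    <= N (mxpowR ((M *m invmx Y)^t* *m (M *m invmx Y)) (s / t)) `^ t
       * N (mxpowR (Y *m Y^t*) (s / (1 - t))) `^ (1 - t).
Proof.
move=> Yu t01 s0; have H := norm_mxpowR_hoelder (M *m invmx Y) Y t01 s0.
rewrite (mulmxKV Yu) in H.
rewrite -[X in _ <= _ * X `^ _](norm_mxpowR_gramC _ Yu) in H.
exact: H.
Qed.

Lemma reverse_hoelder_quotient (M Y : 'M[R[i]]_n.+1) (t s : R) :
  Y \in unitmx -> 1 < t -> 0 < s ->
  N (mxpowR ((M *m invmx Y)^t* *m (M *m invmx Y)) (s / t)) `^ t
    * N (mxpowR (Y *m Y^t*) (s / (1 - t))) `^ (1 - t)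
    <= N (mxpowR (M^t* *m M) s).
Proof.
move=> Yu t1 s0; have t0 : 0 < t by lra.
have tV01 : 0 < t^-1 < 1 by rewrite invr_gt0 t0 invf_lt1.
have st0 : 0 < s / t by rewrite divr_gt0.
(* Hoelder with weight [t^-1] and exponent [s / t] bounds the norm of the quotient; [powR_mul_le]
   then solves for the norm coming from [M]. *)
have H := norm_mxpowR_hoelder M (invmx Y) tV01 st0.
have Ystar_unit : Y^t* \in unitmx.
  have : (invmx Y)^t* *m Y^t* = 1%:M.
    by rewrite -trmxC_mul mulmxV// trmx1 map_mx1.
  by case/mulmx1_unit.
have YYpd : posdefmx (Y *m Y^t*).
  by have := posdefmx_gram Ystar_unit; rewrite trmxCK.
have YYinv : (Y *m Y^t*) *m ((invmx Y)^t* *m invmx Y) = 1%:M.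
  rewrite mulmxA -(mulmxA Y) -trmxC_mul mulVmx// trmx1 map_mx1 mulmx1.
  by rewrite mulmxV.
have E1 : s / t / t^-1 = s by field; rewrite gt_eqF.
have E2 : - (s / t / (1 - t^-1)) = s / (1 - t).
  by field; rewrite subr_eq0 lt_eqF ?(gt_eqF t0)//= subr_eq0 gt_eqF.
rewrite [X in _ <= _ * X `^ _](norm_mxpowR_inv _ YYpd YYinv) in H.
rewrite E1 in H.
rewrite E2 in H.
apply: (powR_mul_le t1 _ _ _ H); first exact: norm_ge0.
  exact: norm_mxpowR_gt0.
exact: norm_ge0.
Qed.

End NormHoelder.

(** * Optimal and near-optimal factorizations *)

Section PerturbedPower.
Variables (R : realType) (delta s t : R).
Hypothesis delta0 : 0 < delta.
Hypothesis s0 : 0 < s.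
Hypothesis t0 : t != 0.
Hypothesis t1 : 1 - t != 0.

(** The intended eigenvalue of the right factor for an eigenvalue [x] of [M^* M]; [delta] replaces 0
    to keep it positive. *)
Definition perturbed_powR (x : R) : R := if x == 0 then delta else x `^ s.

(** Its square is the intended eigenvalue of [Y^* Y], and [perturbed_inv] is the inverse of that
    square. *)
Definition perturbed_sqrt (x : R) : R :=
  perturbed_powR x `^ ((1 - t) / s / 2).

Definition perturbed_inv (x : R) : R :=
  perturbed_powR x `^ (- ((1 - t) / s)).

Lemma perturbed_powR_gt0 x : 0 <= x -> 0 < perturbed_powR x.
Proof.
move=> x0; rewrite /perturbed_powR; case: eqVneq => // xn.
by rewrite powR_gt0// lt_def xn.
Qed.

Lemma perturbed_powR_le x : perturbed_powR x <= x `^ s + delta.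
Proof.
rewrite /perturbed_powR; case: ifP => _; first by rewrite lerDr powR_ge0.
by rewrite lerDl ltW.
Qed.

Lemma perturbed_sqrtM x : 0 <= x ->
  perturbed_sqrt x * perturbed_sqrt x = perturbed_powR x `^ ((1 - t) / s).
Proof.
move=> /perturbed_powR_gt0 w0; rewrite -powRD -?splitr//.
by rewrite (gt_eqF w0) implybT.
Qed.

Lemma perturbed_invP x : 0 <= x ->
  perturbed_sqrt x * perturbed_sqrt x * perturbed_inv x = 1.
Proof.
move=> x0; rewrite perturbed_sqrtM// /perturbed_inv powRN mulfV//.
by rewrite gt_eqF// powR_gt0// perturbed_powR_gt0.
Qed.

Lemma perturbed_sqrtK x : 0 <= x ->
  (perturbed_sqrt x * perturbed_sqrt x) `^ (s / (1 - t)) = perturbed_powR x.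
Proof.
move=> x0; rewrite perturbed_sqrtM// -powRrM.
have -> : (1 - t) / s * (s / (1 - t)) = 1 by field; rewrite t1 gt_eqF.
by rewrite powRr1// ltW// perturbed_powR_gt0.
Qed.

(** For [x != 0] the base is [x^t]. For [x = 0] both sides are 0, the exponents being nonzero, so
    the perturbation does not affect the left factor. *)
Lemma perturbed_invK x : 0 <= x ->
  (x * perturbed_inv x) `^ (s / t) = x `^ s.
Proof.
move=> x0; rewrite /perturbed_inv /perturbed_powR; case: eqVneq => [->|xn].
  by rewrite mul0r !powR0 ?mulf_neq0 ?invr_neq0// gt_eqF.
rewrite -powRrM -[X in (X * _) `^ _](powRr1 x0) -powRD; last first.
  by rewrite xn implybT.
rewrite -powRrM; congr (_ `^ _); field; rewrite t0 gt_eqF//.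
Qed.

End PerturbedPower.

(** * Factorizations parametrized by [Z], and the extremal formulas *)

Section Factorization.
Variables (R : realType) (n : nat) (N : 'M[R[i]]_n.+1 -> R).
Variable Phi : 'rV[R]_n.+1 -> R.
Hypothesis gPhi : symmetric_gauge Phi.
Hypothesis NPhi : forall A, N A = Phi (singular_values A).
Variables (A B K : 'M[R[i]]_n.+1) (p q s : R).
Hypothesis Apd : posdefmx A.
Hypothesis Bpd : posdefmx B.
Hypothesis s0 : 0 < s.
Hypothesis p0 : p != 0.
Hypothesis q0 : q != 0.
Hypothesis pq0 : p + q != 0.

Let t := p / (p + q).
Let M := mxpowR A (p / 2) *m K *m mxpowR B (q / 2).

Let t1E : q / (p + q) = 1 - t.
Proof. by rewrite /t; field. Qed.

Let leftE : s * (p + q) / p = s / t.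
Proof. by rewrite /t; field; rewrite p0 pq0. Qed.

Let rightE : s * (p + q) / q = s / (1 - t).
Proof. by rewrite -t1E; field; rewrite q0 pq0. Qed.

Let t0 : t != 0. Proof. by rewrite mulf_neq0 ?invr_neq0. Qed.
Let t1 : 1 - t != 0. Proof. by rewrite -t1E mulf_neq0 ?invr_neq0. Qed.

Lemma mxpowR_half (Z : 'M[R[i]]_n.+1) r : posdefmx Z ->
  mxpowR Z (r / 2) *m mxpowR Z (r / 2) = mxpowR Z r.
Proof. by move=> Zpd; rewrite (mxpowRD _ _ Zpd) -splitr. Qed.

(** Taken at [B] and [q / 2] it gives the matrix in [Psi], and at [Z] and [- (1 / 2)] the one in
    [left_factor]. *)
Lemma gram_half (Z : 'M[R[i]]_n.+1) r :
  (mxpowR A (p / 2) *m K *m mxpowR Z r)^t*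
    *m (mxpowR A (p / 2) *m K *m mxpowR Z r) =
  mxpowR Z r *m K^t* *m mxpowR A p *m K *m mxpowR Z r.
Proof.
have := mxpowR_half p Apd; have := mxpowR_herm A (p / 2).
have := mxpowR_herm Z r.
move: (mxpowR A (p / 2)) (mxpowR A p) (mxpowR Z r) => a a2 z zE aE <-.
by rewrite !trmxC_mul zE aE !mulmxA.
Qed.

Lemma PsiE : Psi N K A B p q s = N (mxpowR (M^t* *m M) s).
Proof. by rewrite /M gram_half. Qed.

(** For [Y = Z^(1/2) B^(q/2)] the quotient [M Y^-1] is [A^(p/2) K Z^(-1/2)], so each [Z] corresponds
    to a factorization of the fixed matrix [M]. *)
Lemma factorsE Z : posdefmx Z -> exists Y,
  [/\ Y \in unitmx,
    Y^t* *m Y = mxpowR B (q / 2) *m Z *m mxpowR B (q / 2),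
    left_factor N K A p q s Z =
      N (mxpowR ((M *m invmx Y)^t* *m (M *m invmx Y)) (s / t)) &
    right_factor N B p q s Z = N (mxpowR (Y *m Y^t*) (s / (1 - t)))].
Proof.
move=> Zpd; pose Y := mxpowR Z (1 / 2) *m mxpowR B (q / 2).
have Yu : Y \in unitmx.
  rewrite /Y (unitmx_mul (mxpowR Z _)) (mxpowR_unit _ Zpd).
  exact: mxpowR_unit.
have XE : M *m invmx Y = mxpowR A (p / 2) *m K *m mxpowR Z (- (1 / 2)).
  have := mulmx1C (mxpowRN (1 / 2) Zpd).
  move: Yu; rewrite /M /Y; move: (mxpowR A _ *m K) (mxpowR B _) => a b.
  move: (mxpowR Z (1 / 2)) (mxpowR Z (- _)) => z z' Yu zz.
  apply: (can_inj (mulmxK Yu)); rewrite (mulmxKV Yu).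
  by rewrite mulmxA -[in RHS](mulmxA _ z') zz mulmx1.
have [YY YY'] : Y^t* *m Y = mxpowR B (q / 2) *m Z *m mxpowR B (q / 2) /\
    Y *m Y^t* = mxpowR Z (1 / 2) *m mxpowR B q *m mxpowR Z (1 / 2).
  have zz := mxpowR_half 1 Zpd; rewrite (mxpowR1 Zpd) in zz.
  have := mxpowR_half q Bpd.
  have := mxpowR_herm B (q / 2); have := mxpowR_herm Z (1 / 2).
  move: zz; rewrite /Y; move: (mxpowR Z (1 / 2)) (mxpowR B q) => z b2.
  move: (mxpowR B (q / 2)) => b <- zE bE <-.
  by rewrite !trmxC_mul zE bE !mulmxA.
exists Y; clearbody Y; split; [exact: Yu|exact: YY| |].
- have XX := etrans (congr1 (fun X => X^t* *m X) XE) (gram_half Z _).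
  by rewrite /left_factor leftE -XX.
- by rewrite /right_factor rightE -YY'.
Qed.

(** For invertible [K] no eigenvalue is perturbed, which is why the extremum is then attained. *)
Lemma unitmx_K_spectrum (V : 'M[R[i]]_n.+1) d i : K \in unitmx ->
  M^t* *m M = V^t* *m real_diag_mx d *m V -> d 0 i != 0.
Proof.
move=> Ku ME; have Mu : M \in unitmx.
  rewrite /M unitmx_mul (unitmx_mul _ K) Ku (mxpowR_unit _ Apd).
  by rewrite (mxpowR_unit _ Bpd).
apply/eqP => di; have := congr1 determinant ME.
rewrite (det_mulmx _ M) (det_mulmx _ V) (det_mulmx _ (real_diag_mx d)).
rewrite det_real_diag !det_map_mx !det_tr (bigD1 i)//= di mul0r rmorph0.
rewrite mulr0 mul0r => /eqP; rewrite mulf_eq0 conjC_eq0 orbb; apply/negP.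
by rewrite -unitfE -unitmxE.
Qed.

(* In the eigenbasis of [M^* M] the Hoelder inequality is an equality if
   [Y^* Y] has eigenvalues [d_i ^ (1 - t)]; the zero eigenvalues are replaced
   to keep [Z] invertible. *)
Lemma near_optimal (delta : R) : 0 < delta -> exists Z,
  [/\ posdefmx Z, left_factor N K A p q s Z = Psi N K A B p q s,
      right_factor N B p q s Z
        <= Psi N K A B p q s + delta * Phi (const_mx 1) &
      K \in unitmx -> right_factor N B p q s Z = Psi N K A B p q s].
Proof.
move=> delta0; have [V [d [Vu [d0 _] dE]]] := gram_sorted_spectral M.
have MM := gram_herm M.
have PsiE' : Psi N K A B p q s = Phi (\row_i d 0 i `^ s).
  rewrite PsiE (norm_mxpowR gPhi NPhi _ MM _ d0)// dE.
  exact: has_spectrum_unitary.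
pose w := \row_i perturbed_powR delta s (d 0 i).
pose e := \row_i perturbed_sqrt delta s t (d 0 i).
pose f := \row_i perturbed_inv delta s t (d 0 i).
pose g := \row_i (e 0 i * e 0 i).
have gE i : g 0 i = perturbed_sqrt delta s t (d 0 i) ^+ 2 by rewrite !mxE.
have g0 i : 0 <= g 0 i by rewrite gE exprn_ge0 ?powR_ge0.
have gw i : g 0 i `^ (s / (1 - t)) = w 0 i.
  by rewrite gE [RHS]mxE; apply: perturbed_sqrtK.
have gf i : g 0 i * f 0 i = 1 by rewrite gE mxE; apply: perturbed_invP.
have df0 i : 0 <= (\row_i (d 0 i * f 0 i)) 0 i.
  by rewrite !mxE mulr_ge0 ?powR_ge0.
have dfE i : (\row_i (d 0 i * f 0 i)) 0 i `^ (s / t) = d 0 i `^ s.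
  by rewrite !mxE; apply: perturbed_invK.
(* Each coordinate of [w] exceeds that of the unperturbed vector by at most [delta]. *)
have wle : Phi w <= Phi (\row_i d 0 i `^ s) + delta * Phi (const_mx 1).
  rewrite -(ger0_norm (ltW delta0)) -(gaugeZ gPhi).
  apply: le_trans (gauge_leD gPhi _ _); apply: (gauge_le gPhi) => i.
  by rewrite !mxE mulr1 perturbed_powR_le// ltW// perturbed_powR_gt0.
have eu : real_diag_mx e \in unitmx.
  rewrite unitmxE det_real_diag unitfE -(rmorph0 (real_complex R)).
  rewrite (inj_eq (@complexI R)) gt_eqF// prodr_gt0// => i _.
  by rewrite mxE powR_gt0// perturbed_powR_gt0.
(* Chosen so that [T B^(q/2) = E V] with [E] the diagonal matrix of [e]; hence [Z = T^* T] gives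
   [Y^* Y = V^* E^2 V]. *)
pose T := real_diag_mx e *m V *m mxpowR B (- (q / 2)).
have Tu : T \in unitmx.
  rewrite /T unitmx_mul (unitmx_mul _ V) eu (unitarymx_unit Vu).
  by rewrite (mxpowR_unit _ Bpd).
have Zpd := posdefmx_gram Tu; exists (T^t* *m T).
have [Y [Yu YY LE RE]] := factorsE Zpd.
have Tb : T *m mxpowR B (q / 2) = real_diag_mx e *m V.
  have := mulmx1C (mxpowRN (q / 2) Bpd).
  rewrite /T; move: (mxpowR B (- (q / 2))) (mxpowR B (q / 2)) => b' b bb.
  by rewrite -(mulmxA _ b') bb mulmx1.
clearbody T.
have YE : Y^t* *m Y = V^t* *m real_diag_mx g *m V.
  have bE := mxpowR_herm B (q / 2).
  rewrite YY; move: Tb bE; move: (mxpowR B (q / 2)) => b Tb bE.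
  have -> : b *m (T^t* *m T) *m b = (T *m b)^t* *m (T *m b).
    by rewrite (trmxC_mul T b) bE; move: (T^t*) => T'; rewrite !mulmxA.
  rewrite Tb (trmxC_mul _ V) real_diag_mx_herm -real_diag_mxM.
  by move: (V^t*) (real_diag_mx e) => V' E; rewrite !mulmxA.
have RE' : right_factor N B p q s (T^t* *m T) = Phi w.
  have gs : has_spectrum (Y^t* *m Y) g.
    by rewrite YE; apply: has_spectrum_unitary.
  rewrite RE (norm_mxpowR_gramC gPhi NPhi _ Yu).
  rewrite (norm_mxpowR gPhi NPhi _ (gram_herm Y) gs g0).
  by congr Phi; apply/rowP => i; rewrite mxE gw.
have XX := gram_quotient_spectrum Yu Vu dE YE gf.
split; first exact: Zpd.
- rewrite LE PsiE' (norm_mxpowR gPhi NPhi _ (gram_herm _) XX df0).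
  by congr Phi; apply/rowP => i; rewrite mxE dfE [RHS]mxE.
- by rewrite RE' PsiE'; exact: wle.
- move=> Ku; rewrite RE' PsiE'; congr Phi; apply/rowP => i.
  have di := unitmx_K_spectrum i Ku dE.
  by rewrite !mxE /perturbed_powR (negbTE di).
Qed.

Lemma left_factor_ge0 Z : 0 <= left_factor N K A p q s Z.
Proof. exact: norm_ge0 gPhi NPhi _. Qed.

Lemma right_factor_gt0 Z : posdefmx Z -> 0 < right_factor N B p q s Z.
Proof.
move=> Zpd; have [Y [Yu _ _ ->]] := factorsE Zpd.
rewrite [ltRHS](norm_mxpowR_gramC gPhi NPhi _ Yu).
exact: (norm_mxpowR_gt0 gPhi NPhi _ (posdefmx_gram Yu)).
Qed.

Lemma product_formE Z : product_form N K A B p q s Z =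
  left_factor N K A p q s Z `^ t * right_factor N B p q s Z `^ (1 - t).
Proof. by rewrite /product_form t1E. Qed.

Lemma sum_formE Z : sum_form N K A B p q s Z =
  t * left_factor N K A p q s Z + (1 - t) * right_factor N B p q s Z.
Proof. by rewrite /sum_form t1E. Qed.

Lemma forms_eq_Psi : K \in unitmx -> exists Z, [/\ posdefmx Z,
  product_form N K A B p q s Z = Psi N K A B p q s &
  sum_form N K A B p q s Z = Psi N K A B p q s].
Proof.
(* The value [delta = 1] is arbitrary. *)
move=> Ku; have [Z [Zpd LE _ /(_ Ku) RE]] := near_optimal ltr01.
have := right_factor_gt0 Zpd; rewrite RE => Psi0.
exists Z; split; first exact: Zpd.
  rewrite product_formE LE RE; move: (Psi _ _ _ _ _ _ _) Psi0 => psi psi0.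
  rewrite -powRD; last by rewrite (gt_eqF psi0) implybT.
  have -> : t + (1 - t) = 1 by rewrite addrC subrK.
  exact: powRr1 (ltW psi0).
rewrite sum_formE LE RE -mulrDl.
have -> : t + (1 - t) = 1 by rewrite addrC subrK.
exact: mul1r.
Qed.

(** The sum form suffices, since the product form lies between it and [Psi]. *)
Lemma sum_form_approx (eps : R) : 0 < eps -> exists2 Z, posdefmx Z &
  if t < 1 then sum_form N K A B p q s Z <= Psi N K A B p q s + eps
  else Psi N K A B p q s - eps <= sum_form N K A B p q s Z.
Proof.
move=> eps0; pose c := Phi (const_mx 1).
have c0 : 0 < c.
  by apply: (@gauge_gt0 _ _ _ gPhi _ ord0); rewrite mxE oner_eq0.
(* The sum form differs from [Psi] by [1 - t] times the excess of the right factor, which is at most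
   [delta * c]. *)
pose delta := eps / (`|1 - t| * c).
have t10 : 0 < `|1 - t| by rewrite normr_gt0.
have delta0 : 0 < delta by rewrite divr_gt0// mulr_gt0.
have epsE : `|1 - t| * (delta * c) = eps.
  by rewrite /delta; field; rewrite !gt_eqF.
have [Z [Zpd LE RE _]] := near_optimal delta0; exists Z; first exact: Zpd.
rewrite sum_formE LE; rewrite -/c in RE.
move: (Psi _ _ _ _ _ _ _) (right_factor _ _ _ _ _ _) RE => psi r rle.
case: ifP => [tlt|/negbT].
  have t1' : 0 < 1 - t by rewrite subr_gt0.
  rewrite (gtr0_norm t1') in epsE.
  by have := ler_wpM2l (ltW t1') rle; rewrite mulrDr epsE; lra.
rewrite -leNgt => tge; have t1' : 0 <= t - 1 by rewrite subr_ge0.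
rewrite distrC (ger0_norm t1') in epsE.
by have := ler_wpM2l t1' rle; rewrite mulrDr epsE; lra.
Qed.

Lemma min_posdef_Psi : 0 < t < 1 ->
  min_posdef K (product_form N K A B p q s) (Psi N K A B p q s) /\
  min_posdef K (sum_form N K A B p q s) (Psi N K A B p q s).
Proof.
move=> t01; have /andP[t_gt0 t_lt1] := t01.
have prod_ge Z : posdefmx Z ->
    Psi N K A B p q s <= product_form N K A B p q s Z.
  move=> Zpd; have [Y [Yu _ LE RE]] := factorsE Zpd.
  rewrite product_formE PsiE LE RE.
  exact: (hoelder_quotient gPhi NPhi M Yu t01 s0).
have prod_le Z : posdefmx Z ->
    product_form N K A B p q s Z <= sum_form N K A B p q s Z.
  move=> Zpd; rewrite product_formE sum_formE.
  exact: young_powR t01 (left_factor_ge0 Z) (ltW (right_factor_gt0 Zpd)).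
(* A lower bound of the product form also bounds the larger sum form from below, so this serves both
   infima. *)
have glb l : (forall Z, posdefmx Z -> l <= sum_form N K A B p q s Z) ->
    l <= Psi N K A B p q s.
  move=> lb; apply/ler_addgt0Pr => eps /sum_form_approx[Z Zpd].
  by rewrite t_lt1; apply: le_trans; apply: lb.
split; split.
- split=> [_ [Z Zpd <-]|l lb]; first exact: prod_ge.
  apply: glb => Z Zpd; apply: le_trans (prod_le Z Zpd).
  by apply: lb; exists Z.
- by move=> /forms_eq_Psi[Z [Zpd PZ _]]; exists Z.
- split=> [_ [Z Zpd <-]|l lb].
    exact: le_trans (prod_ge Z Zpd) (prod_le Z Zpd).
  by apply: glb => Z Zpd; apply: lb; exists Z.
- by move=> /forms_eq_Psi[Z [Zpd _ SZ]]; exists Z.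
Qed.

Lemma max_posdef_Psi : 1 < t ->
  max_posdef K (product_form N K A B p q s) (Psi N K A B p q s) /\
  max_posdef K (sum_form N K A B p q s) (Psi N K A B p q s).
Proof.
move=> t_gt1.
have prod_le Z : posdefmx Z ->
    product_form N K A B p q s Z <= Psi N K A B p q s.
  move=> Zpd; have [Y [Yu _ LE RE]] := factorsE Zpd.
  rewrite product_formE PsiE LE RE.
  exact: (reverse_hoelder_quotient gPhi NPhi M Yu t_gt1 s0).
have prod_ge Z : posdefmx Z ->
    sum_form N K A B p q s Z <= product_form N K A B p q s Z.
  move=> Zpd; rewrite product_formE sum_formE.
  exact: young_powR_rev t_gt1 (left_factor_ge0 Z) (right_factor_gt0 Zpd).
have lub u : (forall Z, posdefmx Z -> sum_form N K A B p q s Z <= u) ->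
    Psi N K A B p q s <= u.
  move=> ub; apply/ler_addgt0Pr => eps /sum_form_approx[Z Zpd].
  rewrite ltNge (ltW t_gt1)/= lerBlDr => /le_trans; apply.
  by rewrite lerD2r; apply: ub.
split; split.
- split=> [_ [Z Zpd <-]|u ub]; first exact: prod_le.
  apply: lub => Z Zpd; apply: le_trans (prod_ge Z Zpd) _.
  by apply: ub; exists Z.
- by move=> /forms_eq_Psi[Z [Zpd PZ _]]; exists Z.
- split=> [_ [Z Zpd <-]|u ub].
    exact: le_trans (prod_ge Z Zpd) (prod_le Z Zpd).
  by apply: lub => Z Zpd; apply: ub; exists Z.
- by move=> /forms_eq_Psi[Z [Zpd _ SZ]]; exists Z.
Qed.

End Factorization.

Theorem theorem3p1 (R : realType) (n : nat) (N : 'M[R[i]]_n.+1 -> R)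
    (A B K : 'M[R[i]]_n.+1) (p q s : R) :
  symmetric_norm N -> posdefmx A -> posdefmx B ->
  ([/\ 0 < s, 0 < p & 0 < q] \/ [/\ 0 < s, p < 0 & q < 0] ->
     min_posdef K (product_form N K A B p q s) (Psi N K A B p q s) /\
     min_posdef K (sum_form N K A B p q s) (Psi N K A B p q s)) /\
  ([/\ 0 < s, 0 < p, q < 0 & 0 < p + q] \/
   [/\ 0 < s, p < 0, 0 < q & p + q < 0] ->
     max_posdef K (product_form N K A B p q s) (Psi N K A B p q s) /\
     max_posdef K (sum_form N K A B p q s) (Psi N K A B p q s)).
Proof.
(* For [t = p / (p + q)], the sign conditions of the first part give [0 < t < 1], and those of the
   second give [1 < t]. *)
move=> [_ [Phi gPhi NPhi]] Apd Bpd; split=> [[]|[]].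
- move=> [s0 p0 q0]; have pq0 : 0 < p + q by rewrite addr_gt0.
  apply: (min_posdef_Psi gPhi NPhi) => //; rewrite ?gt_eqF//.
  by rewrite divr_gt0//= ltr_pdivrMr// mul1r ltrDl.
- move=> [s0 p0 q0]; have pq0 : p + q < 0 by lra.
  apply: (min_posdef_Psi gPhi NPhi) => //; rewrite ?lt_eqF//.
  by rewrite nmulr_rgt0// invr_lt0 pq0/= ltr_ndivrMr// mul1r gtrDl.
- move=> [s0 p0 q0 pq0].
  apply: (max_posdef_Psi gPhi NPhi) => //;
    rewrite ?(gt_eqF p0) ?(lt_eqF q0) ?(gt_eqF pq0)//.
  by rewrite ltr_pdivlMr// mul1r gtrDl.
- move=> [s0 p0 q0 pq0].
  apply: (max_posdef_Psi gPhi NPhi) => //;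
    rewrite ?(lt_eqF p0) ?(gt_eqF q0) ?(lt_eqF pq0)//.
  by rewrite ltr_ndivlMr// mul1r ltrDl.
Qed.
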